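(* For real $x>0$ let $D(x)=\sum_{n\le x} d(n)$ and define $\Delta(x)$ by $$D(x)=x\log x+(2\gamma-1)x+\tfrac14+\Delta(x).$$ Then for every real $x>0$ we have $\Delta(x)=A(x)+B(x)$, where $$A(x)=-2\sum_{m\le\sqrt{x}}\psi\left(\frac{x}{m}\right)$$ and $$B(x)=4x\int_{\sqrt{x}}^{\infty}\frac{\psi_2(u)}{u^3}\,du-\psi^2(\sqrt{x})-2\psi_2(\sqrt{x})=O(1).$$ In addition, if $x$ is a positive integer, then $$A(x)=\frac{1}{\pi i}\sum_{m\le\sqrt{x}}\ \sum_{r=1}^{m-1}e^{\frac{2\pi i r x}{m}}\left(\frac1r-2r\sum_{v\ge1}\frac{1}{m^2v^2-r^2}\right)+O(d(x)).$$
   Context: For a positive integer $n$, $d(n)$ is the number of positive divisors of $n$. Sums over $n\le x$ or $m\le\sqrt{x}$ run over positive integers. $\gamma$ is Euler's constant. For real $u$, $[u]$ is the integral part of $u$, $\psi(u)=u-[u]-\tfrac12$, and $\psi_2(u)=\tfrac12 B_2(u-[u])$, where $B_2(t)=t^2-t+\tfrac16$ is the Bernoulli polynomial of degree 2. $\psi^2(u)$ means $(\psi(u))^2$. All constants implied by $O$ are absolute. *)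

(* Defs.v *)
(* Stdlib reals with Coquelicot. *)
From Stdlib Require Import Reals List.
From Coquelicot Require Import Coquelicot.
Open Scope R_scope.

Definition num_div (n : nat) : nat :=
  length (filter (fun k => Nat.eqb (Nat.modulo n k) 0) (seq 1 n)).

(* Sum over the integers 1 <= n <= y (empty if y < 1), with values in R or C. *)
Definition sum_upto {G : AbelianMonoid} (y : R) (f : nat -> G) : G :=
  sum_n_m f 1 (Z.to_nat (Int_part y)).

(* The sequence converges, so [real] only drops the Rbar wrapper. *)
Definition euler_gamma : R :=
  real (Lim_seq (fun n => sum_n_m (fun k => / INR k) 1 n - ln (INR n))).

(* [frac_part u] is u - [u], with [u] the floor of u also for u < 0. *)
Definition psi (u : R) : R := frac_part u - 1 / 2.

Definition B2 (t : R) : R := t ^ 2 - t + 1 / 6.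

Definition psi2 (u : R) : R := 1 / 2 * B2 (frac_part u).

Definition D_d (x : R) : R := sum_upto x (fun n => INR (num_div n)).

Definition Delta_d (x : R) : R :=
  D_d x - (x * ln x + (2 * euler_gamma - 1) * x + 1 / 4).

Definition A_term (x : R) : R :=
  - 2 * sum_upto (sqrt x) (fun m => psi (x / INR m)).

Definition B_term (x : R) : R :=
  4 * x * RInt_gen (fun u => psi2 u / u ^ 3)
            (at_point (sqrt x)) (Rbar_locally p_infty)
  - (psi (sqrt x)) ^ 2 - 2 * psi2 (sqrt x).

Definition Cexp (z : C) : C :=
  (exp (Re z) * cos (Im z), exp (Re z) * sin (Im z)).

(* 1/r - 2 r sum_{v >= 1} 1/(m^2 v^2 - r^2); [Series] starts at 0, so v is
   shifted by one.  For 1 <= r < m no denominator vanishes. *)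
Definition coef (m r : nat) : R :=
  1 / INR r
  - 2 * INR r * Series (fun k => 1 / (INR m ^ 2 * INR (S k) ^ 2 - INR r ^ 2)).

Definition exp_sum (x : R) : C :=
  (1 / (RtoC PI * Ci) *
   sum_upto (sqrt x) (fun m =>
     sum_n_m (fun r =>
       Cexp (2 * RtoC PI * Ci * RtoC (INR r) * RtoC x / RtoC (INR m))
       * RtoC (coef m r)) 1 (m - 1)%nat))%C.

(* Main.v *)
Require Import Defs.
From Stdlib Require Import Reals.
From Coquelicot Require Import Coquelicot.
From Stdlib Require Import ZArith List Lra Lia.
Open Scope R_scope.

(** Write [s] for [sqrt x] and [N] for the floor of [s].

    The decomposition of [Delta_d] is the hyperbola method: [D_d x] is twice the
    sum of the floors of [x / m] over [m <= N], minus [N ^ 2] ([hyperbola]).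
    Replacing each floor by [x / m - psi (x / m) - 1 / 2] leaves [A_term x] and
    [2 x] times a harmonic sum, and Euler-Maclaurin summation evaluates the
    latter exactly as [ln s + gamma - psi s / s - psi2 s / s ^ 2] plus twice the
    tail integral of [psi2 u / u ^ 3].  The integral is handled through its
    explicit piecewise primitive [em_branch], whose branches agree at the
    integers and which tends to [gamma / 2] at infinity ([RInt_gen_psi2]).
    Since [psi2] is at most [1 / 12] in absolute value, the tail is at most
    [1 / (24 x)], which bounds [B_term].

    For the exponential sum, expand [2 r / (m ^ 2 v ^ 2 - r ^ 2)] into partial
    fractions: [coef m r] is the symmetric sum of [1 / k] over all integers [k]
    congruent to [r] modulo [m] ([is_lim_seq_coef]).  It is odd under the
    reflection of [r] to [m - r], so the cosine parts of the inner sum cancel,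
    while its sine parts reassemble into twice the full series of
    [sin (k t) / k] with [t = 2 pi n / m] ([sine_sum_by_residue]).  That series
    is the sawtooth [(pi - t) / 2] on the open period ([sine_series]) and [0] at
    the multiples of the period.  Hence the inner sum divided by [pi i] is
    exactly [- 2 psi (n / m)] when [m] does not divide [n] and [0] instead of
    [1] when it does.  The error is therefore the number of divisors of [n] up
    to [sqrt n] ([A_term_exp_sum]), and both bounds hold with constant [1]. *)

(** * Floors and finite sums *)

(** Equations between sums or derivatives are typed in the carrier of an algebraic
    structure, which [ring] and [field] do not identify with [R]. *)
Ltac eq_in_R := match goal with |- ?a = ?b => change (@eq R a b) end.
Ltac ring_R := eq_in_R; ring.
Ltac field_R := eq_in_R; field.

Lemma sum_R_S (f : nat -> R) (N : nat) :
  sum_n_m f 1 (S N) = sum_n_m f 1 N + f (S N).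
Proof. apply (sum_n_Sm f); lia. Qed.

Lemma sum_R_0 (f : nat -> R) : sum_n_m f 1 0 = 0.
Proof. apply (sum_n_m_zero f); lia. Qed.

Lemma sum_R_plus (f g : nat -> R) (a b : nat) :
  sum_n_m (fun k => f k + g k) a b = sum_n_m f a b + sum_n_m g a b.
Proof. exact (sum_n_m_plus f g a b). Qed.

Lemma sum_R_scal (c : R) (f : nat -> R) (a b : nat) :
  sum_n_m (fun k => c * f k) a b = c * sum_n_m f a b.
Proof. exact (sum_n_m_mult_l (K := R_Ring) c f a b). Qed.

Lemma sum_R_ext (f g : nat -> R) (a b : nat) :
  (forall k, (a <= k <= b)%nat -> f k = g k) -> sum_n_m f a b = sum_n_m g a b.
Proof. exact (sum_n_m_ext_loc f g a b). Qed.

Lemma sum_R_const (c : R) (N : nat) : sum_n_m (fun _ => c) 1 N = INR N * c.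
Proof. rewrite sum_n_m_const. do 2 f_equal; lia. Qed.

Lemma sum_R_zero (f : nat -> R) (a b : nat) :
  (forall k, (a <= k <= b)%nat -> f k = 0) -> sum_n_m f a b = 0.
Proof.
intros Hf. rewrite (sum_R_ext _ (fun _ => 0 * 0)).
- rewrite (sum_R_scal 0 (fun _ => 0)). apply Rmult_0_l.
- intros k Hk. rewrite Hf by easy. ring.
Qed.

Lemma sum_R_switch (f : nat -> nat -> R) (M N : nat) :
  sum_n_m (fun a => sum_n_m (fun b => f a b) 1 N) 1 M
  = sum_n_m (fun b => sum_n_m (fun a => f a b) 1 M) 1 N.
Proof.
induction M as [|M IH].
- rewrite sum_R_0. symmetry. apply sum_R_zero. intros b _. apply sum_R_0.
- rewrite sum_R_S, IH. simpl. rewrite <- sum_R_plus.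
  apply sum_R_ext. intros b _. now rewrite sum_R_S.
Qed.

Lemma sum_R_reverse (f : nat -> R) (N : nat) :
  sum_n_m (fun k => f (S N - k)%nat) 1 N = sum_n_m f 1 N.
Proof.
revert f. induction N as [|N IH]; intros f.
- now rewrite !sum_R_0.
- rewrite sum_R_S.
  rewrite (sum_R_ext _ (fun k => (fun j => f (S j)) (S N - k)%nat)).
  + rewrite (IH (fun j => f (S j))).
    rewrite (sum_Sn_m f 1 (S N)) by lia.
    rewrite sum_n_m_S.
    replace (S (S N) - S N)%nat with 1%nat by lia.
    apply Rplus_comm.
  + intros k Hk. f_equal. lia.
Qed.

Lemma sum_R_nonneg (f : nat -> R) (a b : nat) :
  (forall k, 0 <= f k) -> 0 <= sum_n_m f a b.
Proof.
intros Hf. replace 0 with (sum_n_m (fun _ : nat => 0) a b).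
- now apply sum_n_m_le.
- now apply sum_R_zero.
Qed.

Lemma INR_S_pos (n : nat) : 0 < INR (S n).
Proof. apply lt_0_INR; lia. Qed.

Lemma nat_floor_exists (u : R) : 0 <= u -> exists k : nat, INR k <= u < INR k + 1.
Proof.
intros Hu. destruct (base_Int_part u) as [H1 H2].
assert (0 <= Int_part u)%Z.
{ apply Z.lt_succ_r, lt_IZR. rewrite succ_IZR. lra. }
exists (Z.to_nat (Int_part u)). rewrite INR_IZR_INZ, Z2Nat.id by easy. lra.
Qed.

Lemma Int_part_nat (k : nat) (u : R) :
  INR k <= u < INR k + 1 -> Int_part u = Z.of_nat k.
Proof.
intros H. symmetry. apply Int_part_spec. rewrite <- INR_IZR_INZ. lra.
Qed.

Lemma frac_part_nat (k : nat) (u : R) :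
  INR k <= u < INR k + 1 -> frac_part u = u - INR k.
Proof.
intros H. unfold frac_part. now rewrite (Int_part_nat k), <- INR_IZR_INZ.
Qed.

Lemma sum_upto_nat {G : AbelianMonoid} (k : nat) (u : R) (f : nat -> G) :
  INR k <= u < INR k + 1 -> sum_upto u f = sum_n_m f 1 k.
Proof.
intros H. unfold sum_upto. now rewrite (Int_part_nat k), Nat2Z.id.
Qed.

Lemma floor_div (X m : nat) (x : R) : (1 <= m)%nat ->
  INR X <= x < INR X + 1 -> INR (X / m) <= x / INR m < INR (X / m) + 1.
Proof.
intros Hm Hx. assert (Hm' : 0 < INR m) by (apply lt_0_INR; lia).
assert (H1 : (m * (X / m) <= X)%nat) by (apply Nat.Div0.mul_div_le).
assert (H2 : (X + 1 <= m * (X / m + 1))%nat).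
{ pose proof (Nat.mul_succ_div_gt X m ltac:(lia)). lia. }
apply le_INR in H1, H2. rewrite mult_INR in H1, H2. rewrite !plus_INR in H2.
simpl (INR 1) in H2. split.
- apply Rle_div_r; [easy|]. nra.
- apply Rlt_div_l; [easy|]. nra.
Qed.

Lemma floor_sqrt (X : nat) (x : R) :
  INR X <= x < INR X + 1 ->
  INR (Nat.sqrt X) <= sqrt x < INR (Nat.sqrt X) + 1.
Proof.
intros Hx. pose proof (pos_INR X). pose proof (pos_INR (Nat.sqrt X)) as HN.
pose proof (Nat.sqrt_specif X) as [H1 H2].
assert (H3 : (X + 1 <= S (Nat.sqrt X) * S (Nat.sqrt X))%nat) by lia.
apply le_INR in H1, H3. rewrite mult_INR in H1, H3.
rewrite plus_INR, (S_INR (Nat.sqrt X)) in H3. simpl (INR 1) in H3.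
split.
- rewrite <- (sqrt_square (INR (Nat.sqrt X))) by easy. apply sqrt_le_1_alt. lra.
- rewrite <- (sqrt_square (INR (Nat.sqrt X) + 1)) by lra.
  apply sqrt_lt_1_alt. split; lra.
Qed.

(** * Divisor sums and the hyperbola method *)

(** Indicators are real valued so that counting arguments become identities
    between real sums. *)
Definition indicator (b : bool) : R := if b then 1 else 0.

Definition divides_b (n k : nat) : bool := Nat.eqb (Nat.modulo n k) 0.

Lemma ind_nonneg (b : bool) : 0 <= indicator b.
Proof. destruct b; simpl; lra. Qed.

Lemma INR_num_div (n : nat) :
  INR (num_div n) = sum_n_m (fun k => indicator (divides_b n k)) 1 n.
Proof.
unfold num_div. fold (divides_b n). generalize n at 2 4. intros N.
induction N as [|N IH].
- rewrite sum_R_0. easy.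
- rewrite seq_S, filter_app, length_app, plus_INR, IH, sum_R_S.
  simpl. destruct (divides_b n (S N)); simpl; ring.
Qed.

Lemma div_S_indicator (X a : nat) : (1 <= a)%nat ->
  INR (S X / a) = INR (X / a) + indicator (divides_b (S X) a).
Proof.
intros Ha. unfold divides_b.
pose proof (Nat.div_mod_eq X a). pose proof (Nat.div_mod_eq (S X) a).
pose proof (Nat.mod_upper_bound X a ltac:(lia)).
pose proof (Nat.mod_upper_bound (S X) a ltac:(lia)).
destruct (Nat.eqb_spec (S X mod a) 0) as [E|E]; simpl.
- replace (S X / a)%nat with (S (X / a)); [now rewrite S_INR|]. nia.
- replace (S X / a)%nat with (X / a)%nat; [ring|]. nia.
Qed.

(** Passing from [X] to [S X] raises [X / a] by one exactly when [a] divides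
    [S X]; the new term [a = S X] starts from [X / S X = 0]. *)
Lemma sum_num_div (X : nat) :
  sum_n_m (fun n => INR (num_div n)) 1 X = sum_n_m (fun a => INR (X / a)) 1 X.
Proof.
induction X as [|X IH].
- now rewrite !sum_R_0.
- rewrite sum_R_S, IH, INR_num_div.
  rewrite (sum_R_ext (fun a => INR (S X / a))
             (fun a => INR (X / a) + indicator (divides_b (S X) a))).
  + rewrite sum_R_plus, (sum_R_S (fun a => INR (X / a))).
    rewrite (Nat.div_small X (S X)) by lia. simpl (INR 0). ring_R.
  + intros a Ha. apply div_S_indicator. lia.
Qed.

Lemma sum_ind_le (Q M : nat) : (Q <= M)%nat ->
  sum_n_m (fun b => indicator (Nat.leb b Q)) 1 M = INR Q.
Proof.
intros H. transitivity (INR (Nat.min M Q)); [|f_equal; lia]. clear H.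
induction M as [|M IH].
- rewrite sum_R_0. easy.
- rewrite sum_R_S, IH.
  destruct (Nat.leb_spec (S M) Q); cbn [indicator].
  + replace (Nat.min (S M) Q) with (S (Nat.min M Q)) by lia.
    now rewrite S_INR.
  + replace (Nat.min (S M) Q) with (Nat.min M Q) by lia. apply Rplus_0_r.
Qed.

Lemma div_eq_count (X a : nat) : (1 <= a)%nat ->
  INR (X / a) = sum_n_m (fun b => indicator (Nat.leb (a * b) X)) 1 X.
Proof.
intros Ha. rewrite <- (sum_ind_le (X / a) X).
- apply sum_R_ext. intros b Hb. f_equal.
  destruct (Nat.leb_spec b (X / a)); destruct (Nat.leb_spec (a * b) X); try easy.
  + pose proof (Nat.Div0.mul_div_le X a). nia.
  + pose proof (Nat.div_le_lower_bound X a b). lia.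
- apply Nat.Div0.div_le_upper_bound. nia.
Qed.

Lemma sum_restrict (f : nat -> R) (N M : nat) : (N <= M)%nat ->
  sum_n_m (fun a => indicator (Nat.leb a N) * f a) 1 M = sum_n_m f 1 N.
Proof.
intros H. rewrite (sum_n_m_Chasles _ 1 N M) by lia.
rewrite (sum_R_ext _ f 1 N).
- rewrite (sum_R_zero _ (S N) M); [apply Rplus_0_r|].
  intros k Hk. destruct (Nat.leb_spec k N); [lia|]. simpl. ring.
- intros k Hk. destruct (Nat.leb_spec k N); [|lia]. simpl. ring.
Qed.

(** A pair with [a * b <= X] has [a <= N] or [b <= N] for [N] the integer
    square root of [X], and every pair with both has [a * b <= X]. *)
Lemma hyperbola_pointwise (X a b : nat) :
  indicator (Nat.leb (a * b) X)
  = indicator (Nat.leb a (Nat.sqrt X)) * indicator (Nat.leb (a * b) X)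
    + indicator (Nat.leb b (Nat.sqrt X)) * indicator (Nat.leb (b * a) X)
    + (- 1) * (indicator (Nat.leb a (Nat.sqrt X)) * indicator (Nat.leb b (Nat.sqrt X))).
Proof.
pose proof (Nat.sqrt_specif X) as [H1 H2]. rewrite (Nat.mul_comm b a).
destruct (Nat.leb_spec (a * b) X); destruct (Nat.leb_spec a (Nat.sqrt X));
destruct (Nat.leb_spec b (Nat.sqrt X)); simpl; try ring; exfalso; nia.
Qed.

Lemma hyperbola (X : nat) :
  sum_n_m (fun n => INR (num_div n)) 1 X
  = 2 * sum_n_m (fun m => INR (X / m)) 1 (Nat.sqrt X) - INR (Nat.sqrt X) ^ 2.
Proof.
set (N := Nat.sqrt X).
assert (HN : (N <= X)%nat) by apply Nat.sqrt_le_lin.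
rewrite sum_num_div.
assert (Hhalf : sum_n_m (fun a => sum_n_m
   (fun b => indicator (Nat.leb a N) * indicator (Nat.leb (a * b) X)) 1 X) 1 X
   = sum_n_m (fun m => INR (X / m)) 1 N).
{ rewrite <- (sum_restrict _ N X HN). apply sum_R_ext. intros a Ha.
  rewrite sum_R_scal, div_eq_count by lia. easy. }
rewrite (sum_R_ext _ (fun a => sum_n_m (fun b => indicator (Nat.leb (a * b) X)) 1 X)).
2:{ intros a Ha. apply div_eq_count. lia. }
rewrite (sum_R_ext _ (fun a =>
  sum_n_m (fun b => indicator (Nat.leb a N) * indicator (Nat.leb (a * b) X)) 1 X
  + sum_n_m (fun b => indicator (Nat.leb b N) * indicator (Nat.leb (b * a) X)) 1 X
  + (- 1) * (indicator (Nat.leb a N)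
             * sum_n_m (fun b => indicator (Nat.leb b N)) 1 X))).
2:{ intros a _. rewrite <- sum_R_scal, <- sum_R_scal, <- !sum_R_plus.
    apply sum_R_ext. intros b _. apply hyperbola_pointwise. }
rewrite !sum_R_plus, sum_R_scal, (sum_R_switch
  (fun a b => indicator (Nat.leb b N) * indicator (Nat.leb (b * a) X))), Hhalf.
rewrite sum_restrict by easy. rewrite sum_R_const, sum_ind_le by easy. ring_R.
Qed.

(** * Euler's constant and the Euler-Maclaurin primitive *)

Definition harmonic (k : nat) : R := sum_n_m (fun j => / INR j) 1 k.

Lemma harmonic_S (k : nat) : harmonic (S k) = harmonic k + / INR (S k).
Proof. apply sum_R_S. Qed.

Lemma ln_le_sub_one (y : R) : 0 < y -> ln y <= y - 1.
Proof.
intros Hy. pose proof (exp_ineq1_le (ln y)) as H. rewrite exp_ln in H by easy. lra.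
Qed.

Lemma ln_increment (a b : R) : 0 < a -> 0 < b -> ln b - ln a <= (b - a) / a.
Proof.
intros Ha Hb. rewrite <- ln_div by easy.
replace ((b - a) / a) with (b / a - 1) by (field; lra).
apply ln_le_sub_one. now apply Rdiv_lt_0_compat.
Qed.

Lemma ln_S_bounds (n : nat) : (1 <= n)%nat ->
  / INR (S n) <= ln (INR (S n)) - ln (INR n) <= / INR n.
Proof.
intros Hn. assert (H : 0 < INR n) by (apply lt_0_INR; lia).
pose proof (ln_increment (INR n) (INR (S n)) H (INR_S_pos n)) as H1.
pose proof (ln_increment (INR (S n)) (INR n) (INR_S_pos n) H) as H2.
replace (INR (S n) - INR n) with 1 in H1 by (rewrite S_INR; ring).
replace (INR n - INR (S n)) with (- (1)) in H2 by (rewrite S_INR; ring).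
unfold Rdiv in H1, H2. lra.
Qed.

Lemma is_lim_seq_harmonic :
  is_lim_seq (fun n => harmonic n - ln (INR n)) euler_gamma.
Proof.
apply Lim_seq_correct'.
set (u := fun n => harmonic n - ln (INR n)).
destruct (ex_finite_lim_seq_decr (fun n => u (S n)) 0) as [l Hl].
- intros n. unfold u. rewrite (harmonic_S (S n)).
  pose proof (ln_S_bounds (S n) ltac:(lia)). lra.
- intros n. unfold u.
  assert (H : ln (INR (S (S n))) <= harmonic (S n)).
  { induction n as [|n IH].
    - unfold harmonic. rewrite sum_R_S, sum_R_0.
      pose proof (ln_le_sub_one (1 + 1) ltac:(lra)). simpl. rewrite Rinv_1. lra.
    - rewrite harmonic_S. pose proof (ln_S_bounds (S (S n)) ltac:(lia)). lra. }
  pose proof (ln_S_bounds (S n) ltac:(lia)).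
  pose proof (Rinv_0_lt_compat _ (INR_S_pos (S n))). lra.
- exists l. now apply is_lim_seq_incr_1.
Qed.

(** The two sides are an increasing and a decreasing sequence in [N] with the
    common limit [euler_gamma]. *)
Lemma gamma_bounds (N : nat) : (1 <= N)%nat ->
  harmonic N - ln (INR (S N)) <= euler_gamma <= harmonic N - ln (INR N).
Proof.
intros HN.
assert (Hinc : forall j, harmonic N - ln (INR (S N))
   <= harmonic (j + N) - ln (INR (S (j + N)))).
{ induction j as [|j IH]; [apply Rle_refl|].
  rewrite Nat.add_succ_l, harmonic_S.
  pose proof (ln_S_bounds (S (j + N)) ltac:(lia)). lra. }
assert (Hdec : forall j, harmonic (j + N) - ln (INR (j + N))
   <= harmonic N - ln (INR N)).
{ induction j as [|j IH]; [apply Rle_refl|].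
  rewrite Nat.add_succ_l, harmonic_S.
  pose proof (ln_S_bounds (j + N) ltac:(lia)). lra. }
pose proof is_lim_seq_harmonic as Hl.
apply (is_lim_seq_incr_n _ N) in Hl. split.
- refine (is_lim_seq_le _ _ (Finite _) (Finite _) _ (is_lim_seq_const _) Hl).
  intros j. specialize (Hinc j). pose proof (ln_S_bounds (j + N) ltac:(lia)).
  pose proof (Rinv_0_lt_compat _ (INR_S_pos (j + N))). lra.
- exact (is_lim_seq_le _ _ (Finite _) (Finite _) Hdec Hl (is_lim_seq_const _)).
Qed.

(** On [[k, k+1]] this is a primitive of [- psi2 u / u ^ 3], found by integrating
    [psi / u ^ 2] by parts.  The constant [harmonic k] makes the branches agree
    at the integers, where the jump [- 1] of [psi] costs [- 1 / k]. *)
Definition em_branch (k : nat) (u : R) : R :=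
  1 / 2 * (harmonic k - ln u + (u - INR k - 1 / 2) / u
           + B2 (u - INR k) / (2 * u ^ 2)).

Lemma em_branch_glue (k : nat) :
  em_branch (S k) (INR (S k)) = em_branch k (INR (S k)).
Proof.
unfold em_branch, B2. rewrite harmonic_S.
pose proof (INR_S_pos k) as H. rewrite S_INR in *. field. lra.
Qed.

Lemma is_derive_em_branch (k : nat) (u : R) : 0 < u ->
  is_derive (em_branch k) u (- (1 / 2 * B2 (u - INR k) / u ^ 3)).
Proof.
intros Hu. unfold em_branch, B2. auto_derive.
- repeat split; try easy; try apply Rgt_not_eq; nra.
- field. lra.
Qed.

Lemma is_RInt_em_branch (k : nat) (a b : R) :
  0 < a -> a <= b -> INR k <= a -> b <= INR k + 1 ->
  is_RInt (fun u => psi2 u / u ^ 3) a b (em_branch k a - em_branch k b).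
Proof.
intros Ha Hab Hka Hkb.
apply (is_RInt_ext (fun u => 1 / 2 * B2 (u - INR k) / u ^ 3)).
{ rewrite Rmin_left, Rmax_right by easy. intros u Hu.
  unfold psi2. rewrite (frac_part_nat k) by lra. reflexivity. }
replace (em_branch k a - em_branch k b)
  with (minus (- em_branch k b) (- em_branch k a))
  by (unfold minus, plus, opp; simpl; ring).
apply (is_RInt_derive (fun u => - em_branch k u));
  rewrite Rmin_left, Rmax_right by easy; intros u Hu.
- replace (1 / 2 * B2 (u - INR k) / u ^ 3)
    with (opp (- (1 / 2 * B2 (u - INR k) / u ^ 3)))
    by (unfold opp; simpl; ring).
  apply (is_derive_opp (em_branch k)). apply is_derive_em_branch. lra.
- apply (ex_derive_continuous (fun u => 1 / 2 * B2 (u - INR k) / u ^ 3)).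
  unfold B2. auto_derive. apply Rgt_not_eq, (pow_lt u 3). lra.
Qed.

(** Induction on the number [j] of integers crossed: the branches telescope. *)
Lemma is_RInt_em_chain (j k : nat) (a b : R) :
  0 < a -> a <= b -> INR k <= a < INR k + 1 ->
  INR (k + j) <= b < INR (k + j) + 1 ->
  is_RInt (fun u => psi2 u / u ^ 3) a b (em_branch k a - em_branch (k + j) b).
Proof.
revert k a. induction j as [|j IH]; intros k a Ha Hab Hk Hb.
- rewrite Nat.add_0_r in *. apply is_RInt_em_branch; lra.
- replace (k + S j)%nat with (S k + j)%nat in * by lia.
  assert (Hle : INR (S k) <= b).
  { apply Rle_trans with (INR (S k + j)); [apply le_INR; lia | lra]. }
  pose proof (INR_S_pos k).
  replace (em_branch k a - em_branch (S k + j) b)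
    with (plus (em_branch k a - em_branch k (INR (S k)))
               (em_branch (S k) (INR (S k)) - em_branch (S k + j) b))
    by (rewrite em_branch_glue; unfold plus; simpl; ring).
  apply (is_RInt_Chasles (V := R_NormedModule) _ a (INR (S k)) b).
  + apply is_RInt_em_branch; rewrite ?S_INR in *; lra.
  + apply IH; try easy; rewrite ?S_INR in *; lra.
Qed.

Lemma psi2_bound (u : R) : Rabs (psi2 u) <= 1 / 12.
Proof.
unfold psi2, B2. destruct (base_fp u) as [H1 H2]. apply Rabs_le. nra.
Qed.

Lemma RInt_psi2_bound (a b l : R) : 0 < a -> a <= b ->
  is_RInt (fun u => psi2 u / u ^ 3) a b l -> Rabs l <= 1 / (24 * a ^ 2).
Proof.
intros Ha Hab Hl.
assert (Hg : is_RInt (fun u => 1 / 12 / u ^ 3) a b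
   (minus (- (1 / (24 * b ^ 2))) (- (1 / (24 * a ^ 2))))).
{ apply (is_RInt_derive (fun u => - (1 / (24 * u ^ 2))));
    rewrite Rmin_left, Rmax_right by easy; intros u Hu.
  - auto_derive; [apply Rgt_not_eq; nra|]. field. lra.
  - apply (ex_derive_continuous (fun u => 1 / 12 / u ^ 3)).
    auto_derive. apply Rgt_not_eq, (pow_lt u 3). lra. }
apply Rle_trans with (minus (- (1 / (24 * b ^ 2))) (- (1 / (24 * a ^ 2)))).
- refine (norm_RInt_le _ _ a b l _ Hab _ Hl Hg).
  intros u Hu. change norm with Rabs. unfold Rdiv at 1.
  assert (0 < u ^ 3) by (apply pow_lt; lra).
  rewrite Rabs_mult, (Rabs_pos_eq (/ u ^ 3))
    by (now apply Rlt_le, Rinv_0_lt_compat).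
  apply Rmult_le_compat_r; [now apply Rlt_le, Rinv_0_lt_compat|].
  apply psi2_bound.
- unfold minus, plus, opp; simpl.
  assert (0 < / (24 * (b * (b * 1)))) by (apply Rinv_0_lt_compat; nra).
  unfold Rdiv. lra.
Qed.

(** This rate identifies the constant of integration at infinity; it is too weak
    to bound [B_term], which needs [em_tail_bound]. *)
Lemma em_branch_near_gamma (k : nat) (u : R) : (1 <= k)%nat ->
  INR k <= u < INR k + 1 ->
  Rabs (em_branch k u - euler_gamma / 2) <= 2 / INR k.
Proof.
intros Hk Hu. pose proof (le_INR 1 k Hk) as Hk1. simpl in Hk1.
pose proof (gamma_bounds k Hk) as Hg.
pose proof (ln_S_bounds k Hk) as [_ Hs]. rewrite S_INR in *.
assert (H1 : ln (INR k) <= ln u) by (apply ln_le; lra).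
assert (H2 : ln u <= ln (INR k + 1)) by (apply ln_le; lra).
assert (Hinv : / u <= / INR k) by (apply Rinv_le_contravar; lra).
assert (Hupos : 0 < / u) by (apply Rinv_0_lt_compat; lra).
assert (Hu1 : / u <= 1) by (rewrite <- Rinv_1; apply Rinv_le_contravar; lra).
unfold em_branch.
replace (B2 (u - INR k) / (2 * u ^ 2))
  with (B2 (u - INR k) / 2 * / u * / u) by (field; lra).
assert (Hb : Rabs (B2 (u - INR k) / 2) <= 1 / 12).
{ pose proof (psi2_bound u) as H. unfold psi2 in H.
  rewrite (frac_part_nat k) in H by easy.
  replace (B2 (u - INR k) / 2) with (1 / 2 * B2 (u - INR k)) by field. easy. }
apply Rabs_le_between in Hb. set (w := B2 (u - INR k) / 2) in *.
apply Rabs_le. unfold Rdiv. clearbody w. set (v := / u) in *.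
assert (0 <= v * v <= v) by nra.
assert (- v <= (u - INR k - 1 * / 2) * v <= v) by nra.
assert (- v <= w * v * v <= v) by nra.
lra.
Qed.

Lemma is_RInt_gen_psi2 (k : nat) (s : R) : 0 < s -> INR k <= s < INR k + 1 ->
  is_RInt_gen (fun u => psi2 u / u ^ 3) (at_point s) (Rbar_locally p_infty)
    (em_branch k s - euler_gamma / 2).
Proof.
intros Hs Hk P [eps HP].
assert (Hinv : 0 < 2 / eps) by (apply Rdiv_lt_0_compat; [lra|apply cond_pos]).
apply (Filter_prod _ _ _ (fun a => a = s) (fun b => s + 1 + 2 / eps + 1 < b)).
- reflexivity.
- now exists (s + 1 + 2 / eps + 1).
- intros a b -> Hb; simpl.
  destruct (nat_floor_exists b ltac:(lra)) as [n Hn].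
  assert (Hkn : (k <= n)%nat).
  { apply INR_le. lra. }
  exists (em_branch k s - em_branch n b). split.
  + replace n with (k + (n - k))%nat in * by lia.
    apply is_RInt_em_chain; lra.
  + apply HP. change (Rabs (em_branch k s - em_branch n b
      - (em_branch k s - euler_gamma / 2)) < eps).
    replace (em_branch k s - em_branch n b - (em_branch k s - euler_gamma / 2))
      with (- (em_branch n b - euler_gamma / 2)) by ring.
    rewrite Rabs_Ropp.
    assert (H1 : 1 + 2 / eps < INR n) by lra.
    assert (Hn1 : (1 <= n)%nat) by (apply INR_le; simpl; lra).
    eapply Rle_lt_trans; [now apply em_branch_near_gamma|].
    apply Rlt_div_l; [lra|].
    assert (eps * (2 / eps) = 2) by (field; apply Rgt_not_eq, cond_pos).
    pose proof (cond_pos eps). nra.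
Qed.

Lemma RInt_gen_psi2 (k : nat) (s : R) : 0 < s -> INR k <= s < INR k + 1 ->
  RInt_gen (fun u => psi2 u / u ^ 3) (at_point s) (Rbar_locally p_infty)
  = em_branch k s - euler_gamma / 2.
Proof.
intros Hs Hk. apply (is_RInt_gen_unique _ _ (is_RInt_gen_psi2 k s Hs Hk)).
Qed.

(** The difference is the integral of [psi2 u / u ^ 3] from [s] to infinity, and
    [1 / (24 s ^ 2)] is that of [1 / (12 u ^ 3)]. *)
Lemma em_tail_bound (k : nat) (s : R) : 0 < s -> INR k <= s < INR k + 1 ->
  Rabs (em_branch k s - euler_gamma / 2) <= 1 / (24 * s ^ 2).
Proof.
intros Hs Hk. apply le_epsilon. intros eps Heps.
assert (Hinv : 0 < 2 / eps) by (apply Rdiv_lt_0_compat; lra).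
destruct (nat_floor_exists (s + 1 + 2 / eps + 1) ltac:(lra)) as [n Hn].
assert (Hkn : (k <= n)%nat) by (apply INR_le; lra).
assert (H1 : 1 + 2 / eps < INR n) by lra.
assert (Hn1 : (1 <= n)%nat) by (apply INR_le; simpl; lra).
pose proof (em_branch_near_gamma n _ Hn1 Hn) as H2.
assert (H3 : 2 / INR n <= eps).
{ apply Rle_div_l; [lra|]. assert (eps * (2 / eps) = 2) by (field; lra). nra. }
set (b := s + 1 + 2 / eps + 1) in *.
assert (H4 : Rabs (em_branch k s - em_branch n b) <= 1 / (24 * s ^ 2)).
{ apply (RInt_psi2_bound s b); [easy|unfold b; lra|].
  replace n with (k + (n - k))%nat in * by lia.
  apply is_RInt_em_chain; try easy. unfold b; lra. }
replace (em_branch k s - euler_gamma / 2) with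
  (em_branch k s - em_branch n b + (em_branch n b - euler_gamma / 2)) by ring.
eapply Rle_trans; [apply Rabs_triang|]. lra.
Qed.

(** * The decomposition of [Delta_d] and the bound on [B_term] *)

Lemma Delta_decomposition (x : R) : 0 < x -> Delta_d x = A_term x + B_term x.
Proof.
intros Hx. destruct (nat_floor_exists x ltac:(lra)) as [X HX].
set (N := Nat.sqrt X).
assert (HN : INR N <= sqrt x < INR N + 1) by now apply floor_sqrt.
assert (Hs : 0 < sqrt x) by now apply sqrt_lt_R0.
assert (Hss : x = sqrt x * sqrt x) by (symmetry; apply sqrt_sqrt; lra).
unfold Delta_d, D_d, A_term, B_term.
rewrite (sum_upto_nat X) by easy. rewrite hyperbola. fold N.
rewrite (sum_upto_nat N) by easy. rewrite (RInt_gen_psi2 N) by easy.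
rewrite (sum_R_ext (fun m => INR (X / m))
  (fun m => x * / INR m + ((-1) * psi (x / INR m) + (-1) * (1 / 2)))).
2:{ intros m Hm. unfold psi. rewrite (frac_part_nat (X / m)).
    - unfold Rdiv. ring.
    - apply floor_div; [lia|easy]. }
rewrite !sum_R_plus, !sum_R_scal, sum_R_const. fold (harmonic N).
set (T := sum_n_m (fun m => psi (x / INR m)) 1 N).
unfold psi2, psi, em_branch. rewrite (frac_part_nat N) by easy.
replace (ln x) with (2 * ln (sqrt x)).
2:{ rewrite Hss at 2. rewrite ln_mult by easy. ring. }
unfold B2. set (s := sqrt x) in *. rewrite Hss. field. lra.
Qed.

Lemma B_term_bounded (x : R) : 0 < x -> Rabs (B_term x) <= 1.
Proof.
intros Hx. assert (Hs : 0 < sqrt x) by now apply sqrt_lt_R0.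
destruct (nat_floor_exists (sqrt x) ltac:(lra)) as [N HN].
unfold B_term. rewrite (RInt_gen_psi2 N) by easy.
pose proof (em_tail_bound N (sqrt x) Hs HN) as H.
set (e := em_branch N (sqrt x) - euler_gamma / 2) in *.
rewrite <- Rsqr_pow2, Rsqr_sqrt in H by lra.
assert (Hxe : Rabs (4 * x * e) <= 1 / 6).
{ rewrite Rabs_mult, (Rabs_pos_eq (4 * x)) by lra.
  apply Rle_trans with (4 * x * (1 / (24 * x))).
  - apply Rmult_le_compat_l; lra.
  - right. field. lra. }
pose proof (psi2_bound (sqrt x)) as Hp.
destruct (base_fp (sqrt x)) as [H1 H2].
apply Rabs_le_between in Hxe, Hp. unfold psi. apply Rabs_le. nra.
Qed.

(** * The sine series of the sawtooth *)

Lemma is_lim_seq_of_rate (u : nat -> R) (l c : R) :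
  (forall n, Rabs (u n - l) <= c * / INR (S n)) -> is_lim_seq u l.
Proof.
intros H.
assert (H0 : is_lim_seq (fun n => c * / INR (S n)) 0).
{ replace (Finite 0) with (Rbar_mult c (Finite 0)) by (simpl; f_equal; ring).
  apply is_lim_seq_scal_l.
  apply (is_lim_seq_inv (fun n => INR (S n)) p_infty); [|easy].
  apply -> is_lim_seq_incr_1. apply is_lim_seq_INR. }
apply (is_lim_seq_le_le (fun n => l - c * / INR (S n)) _
         (fun n => l + c * / INR (S n))).
- intros n. specialize (H n). apply Rabs_le_between in H. lra.
- replace l with (l - 0) at 1 by ring.
  apply is_lim_seq_minus'; [apply is_lim_seq_const|easy].
- replace l with (l + 0) at 1 by ring.
  apply is_lim_seq_plus'; [apply is_lim_seq_const|easy].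
Qed.

Lemma dirichlet_kernel (K : nat) (t : R) :
  2 * sin (t / 2) * sum_n_m (fun k => cos (INR k * t)) 1 K
  = sin ((INR K + 1 / 2) * t) - sin (t / 2).
Proof.
induction K as [|K IH].
- rewrite sum_R_0. simpl (INR 0).
  replace ((0 + 1 / 2) * t) with (t / 2) by field. ring.
- rewrite sum_R_S, Rmult_plus_distr_l, IH.
  replace ((INR K + 1 / 2) * t) with (INR (S K) * t - t / 2)
    by (rewrite S_INR; field).
  replace ((INR (S K) + 1 / 2) * t) with (INR (S K) * t + t / 2) by field.
  rewrite sin_minus, sin_plus. ring.
Qed.

Lemma is_derive_sine_sum (K : nat) (t : R) :
  is_derive (fun t => sum_n_m (fun k => sin (INR k * t) / INR k) 1 K) t
    (sum_n_m (fun k => cos (INR k * t)) 1 K).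
Proof.
induction K as [|K IH].
- apply (is_derive_ext (fun _ => 0)).
  + intros s. symmetry. apply sum_R_0.
  + rewrite sum_R_0. apply (is_derive_const (V := R_NormedModule) 0).
- apply (is_derive_ext (fun t =>
    plus (sum_n_m (fun k => sin (INR k * t) / INR k) 1 K)
         (sin (INR (S K) * t) / INR (S K)))).
  + intros s. symmetry. apply sum_R_S.
  + rewrite sum_R_S. apply (is_derive_plus (V := R_NormedModule)); [exact IH|].
    generalize (INR (S K)) (INR_S_pos K). intros c Hc.
    auto_derive; [easy|]. field_R. lra.
Qed.

(** The last term is what integrating the oscillating part of the Dirichlet
    kernel by parts produces, so that away from the multiples of [2 PI] the
    derivative is [O (1 / K)]. *)
Definition sine_defect (K : nat) (t : R) : R :=
  sum_n_m (fun k => sin (INR k * t) / INR k) 1 K - (PI - t) / 2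
  + cos ((INR K + 1 / 2) * t) / ((2 * INR K + 1) * sin (t / 2)).

Lemma is_derive_sine_defect (K : nat) (t : R) : 0 < sin (t / 2) ->
  is_derive (sine_defect K) t
    (- (cos ((INR K + 1 / 2) * t) * cos (t / 2)
        / (2 * (2 * INR K + 1) * sin (t / 2) ^ 2))).
Proof.
intros Hs. pose proof (pos_INR K) as HK.
pose proof (dirichlet_kernel K t) as HD.
set (S := sum_n_m (fun k => cos (INR k * t)) 1 K) in *.
replace (- (cos ((INR K + 1 / 2) * t) * cos (t / 2)
        / (2 * (2 * INR K + 1) * sin (t / 2) ^ 2)))
  with (plus S (1 / 2 - sin ((INR K + 1 / 2) * t) / (2 * sin (t / 2))
     - cos ((INR K + 1 / 2) * t) * cos (t / 2)
        / (2 * (2 * INR K + 1) * sin (t / 2) ^ 2))).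
2:{ replace (sin ((INR K + 1 / 2) * t))
      with (2 * sin (t / 2) * S + sin (t / 2)) by lra.
    unfold plus; simpl. field. lra. }
apply (is_derive_ext (fun t =>
  plus (sum_n_m (fun k => sin (INR k * t) / INR k) 1 K)
   (- ((PI - t) / 2)
    + cos ((INR K + 1 / 2) * t) / ((2 * INR K + 1) * sin (t / 2))))).
{ intros s. unfold sine_defect, plus; simpl. ring_R. }
apply (is_derive_plus (V := R_NormedModule)); [apply is_derive_sine_sum|].
auto_derive.
- apply Rgt_not_eq. unfold Rdiv in Hs. nra.
- change (t * / 2) with (t / 2).
  field. lra.
Qed.

Lemma sine_defect_PI (K : nat) : sine_defect K PI = 0.
Proof.
unfold sine_defect. rewrite sum_R_zero.
- replace ((INR K + 1 / 2) * PI) with (PI / 2 + INR K * PI) by field.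
  rewrite cos_plus, cos_PI2, sin_PI2.
  replace (sin (INR K * PI)) with 0; [unfold Rdiv; ring|].
  symmetry. apply sin_eq_0_1. exists (Z.of_nat K). now rewrite INR_IZR_INZ.
- intros k _. replace (sin (INR k * PI)) with 0; [unfold Rdiv; ring|].
  symmetry. apply sin_eq_0_1. exists (Z.of_nat k). now rewrite INR_IZR_INZ.
Qed.

(** [sine_defect] vanishes at [PI], so the mean value theorem turns the size of its
    derivative on [[t, PI]] into a bound at [t]. *)
Lemma sine_series_half (t : R) : 0 < t <= PI ->
  is_lim_seq (fun K => sum_n_m (fun k => sin (INR k * t) / INR k) 1 K)
    ((PI - t) / 2).
Proof.
intros Ht. pose proof PI_RGT_0 as Hpi.
assert (Hs : forall y, t <= y <= PI -> sin (t / 2) <= sin (y / 2)).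
{ intros y Hy. apply sin_incr_1; lra. }
set (s := sin (t / 2)) in *.
assert (Hs0 : 0 < s) by (apply sin_gt_0; lra).
apply (is_lim_seq_of_rate _ _ (PI / s ^ 2 + 1 / s)). intros K.
pose proof (pos_INR K) as HK. pose proof (INR_S_pos K) as HSK.
assert (Hc : Rabs (cos ((INR K + 1 / 2) * t) / ((2 * INR K + 1) * s))
   <= 1 / s * / INR (S K)).
{ unfold Rdiv at 1. rewrite Rabs_mult, (Rabs_pos_eq (/ _)).
  2:{ apply Rlt_le, Rinv_0_lt_compat. nra. }
  assert (Rabs (cos ((INR K + 1 / 2) * t)) <= 1)
    by (apply Rabs_le, COS_bound).
  assert (0 < / ((2 * INR K + 1) * s)) by (apply Rinv_0_lt_compat; nra).
  apply Rle_trans with (/ ((2 * INR K + 1) * s)); [nra|].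
  replace (1 / s * / INR (S K)) with (/ (INR (S K) * s)) by (field; lra).
  apply Rinv_le_contravar; [nra|]. rewrite S_INR. nra. }
assert (Hd : Rabs (sine_defect K t) <= PI / s ^ 2 * / INR (S K)).
{ destruct (MVT_gen (sine_defect K) t PI (fun t =>
    - (cos ((INR K + 1 / 2) * t) * cos (t / 2)
        / (2 * (2 * INR K + 1) * sin (t / 2) ^ 2)))) as [c [Hc1 Hc2]];
    rewrite ?Rmin_left, ?Rmax_right in * by lra.
  - intros y Hy. apply is_derive_sine_defect.
    apply Rlt_le_trans with s; [easy|]. apply Hs; lra.
  - intros y Hy. apply continuity_pt_filterlim.
    apply (ex_derive_continuous (sine_defect K)). eexists.
    apply is_derive_sine_defect.
    apply Rlt_le_trans with s; [easy|]. apply Hs; lra.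
  - rewrite sine_defect_PI in Hc2.
    replace (sine_defect K t) with
      (cos ((INR K + 1 / 2) * c) * cos (c / 2)
        * / (2 * (2 * INR K + 1) * sin (c / 2) ^ 2) * (PI - t))
      by (unfold Rdiv in Hc2 |- *; lra).
    specialize (Hs c Hc1).
    assert (Hs2 : s ^ 2 <= sin (c / 2) ^ 2) by nra.
    assert (Hs3 : 0 < s ^ 2) by (apply pow_lt; lra).
    assert (Hden : / (2 * (2 * INR K + 1) * sin (c / 2) ^ 2)
             <= / (INR (S K) * s ^ 2)).
    { apply Rinv_le_contravar; [nra|]. rewrite S_INR. nra. }
    assert (Hden0 : 0 < / (2 * (2 * INR K + 1) * sin (c / 2) ^ 2)).
    { apply Rinv_0_lt_compat. nra. }
    assert (Hcc : Rabs (cos ((INR K + 1 / 2) * c) * cos (c / 2)) <= 1).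
    { rewrite Rabs_mult. rewrite <- (Rmult_1_r 1).
      apply Rmult_le_compat; try apply Rabs_pos; apply Rabs_le, COS_bound. }
    rewrite !Rabs_mult in *. rewrite (Rabs_pos_eq (/ _)), (Rabs_pos_eq (PI - t))
      by lra.
    replace (PI / s ^ 2 * / INR (S K)) with (1 * / (INR (S K) * s ^ 2) * PI)
      by (field; lra).
    apply Rmult_le_compat; try lra.
    + apply Rmult_le_pos; [|lra]. apply Rmult_le_pos; apply Rabs_pos.
    + apply Rmult_le_compat; try lra. apply Rmult_le_pos; apply Rabs_pos. }
replace (sum_n_m (fun k => sin (INR k * t) / INR k) 1 K - (PI - t) / 2)
  with (sine_defect K t - cos ((INR K + 1 / 2) * t) / ((2 * INR K + 1) * s))
  by (unfold sine_defect; fold s; ring_R).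
eapply Rle_trans; [apply Rabs_triang|]. rewrite Rabs_Ropp.
rewrite (Rmult_plus_distr_r (PI / s ^ 2)). lra.
Qed.

(** The other half of the period follows from oddness about [PI]. *)
Lemma sine_series (t : R) : 0 < t < 2 * PI ->
  is_lim_seq (fun K => sum_n_m (fun k => sin (INR k * t) / INR k) 1 K)
    ((PI - t) / 2).
Proof.
intros Ht. destruct (Rle_or_lt t PI) as [H|H].
- now apply sine_series_half.
- pose proof (sine_series_half (2 * PI - t) ltac:(lra)) as Hl.
  apply is_lim_seq_opp in Hl. simpl in Hl.
  replace (- ((PI - (2 * PI - t)) / 2)) with ((PI - t) / 2) in Hl by field.
  revert Hl. apply is_lim_seq_ext. intros K.
  rewrite <- (Rmult_1_l (sum_n_m _ 1 K)), Ropp_mult_distr_l, <- sum_R_scal.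
  apply sum_R_ext. intros k _.
  replace (INR k * (2 * PI - t)) with (- (INR k * t) + 2 * INR k * PI) by ring.
  rewrite sin_period, sin_neg. unfold Rdiv. ring.
Qed.

(** * The coefficients as a symmetric sum over a residue class *)

(** For [1 <= r <= m] the denominators are the first [V] positive members of the
    class of [r] modulo [m]. *)
Definition residue_sum (m V r : nat) : R :=
  sum_n_m (fun w => / INR (m * (w - 1) + r)) 1 V.

Lemma residue_sum_S (m V r : nat) :
  residue_sum m (S V) r = residue_sum m V r + / INR (m * V + r).
Proof.
unfold residue_sum. rewrite sum_R_S. do 4 f_equal. lia.
Qed.

(** Partial fractions: [1 / (r + m v) + 1 / (r - m v)] is
    [- 2 r / (m ^ 2 v ^ 2 - r ^ 2)], and the terms [r - m v] run through
    the negatives of the class of [m - r]. *)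
Lemma coef_partial (m r V : nat) : (1 <= r)%nat -> (r < m)%nat ->
  1 / INR r - 2 * INR r
    * sum_n_m (fun v => 1 / (INR m ^ 2 * INR v ^ 2 - INR r ^ 2)) 1 V
  = residue_sum m V r - residue_sum m V (m - r) + / INR (m * V + r).
Proof.
intros Hr Hm. assert (Hr' : 1 <= INR r) by (apply (le_INR 1); lia).
assert (Hm' : INR r < INR m) by now apply lt_INR.
induction V as [|V IH].
- unfold residue_sum. rewrite !sum_R_0, Nat.mul_0_r. simpl (0 + r)%nat.
  unfold Rdiv. ring.
- rewrite sum_R_S, !residue_sum_S, Rmult_plus_distr_l.
  replace (residue_sum m V r + / INR (m * V + r)
    - (residue_sum m V (m - r) + / INR (m * V + (m - r))) + / INR (m * S V + r))
   with ((residue_sum m V r - residue_sum m V (m - r) + / INR (m * V + r))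
     - / INR (m * V + (m - r)) + / INR (m * S V + r)) by ring.
  rewrite <- IH.
  replace (m * V + (m - r))%nat with (m * S V - r)%nat by lia.
  assert (HV : (m <= m * S V)%nat) by nia.
  rewrite minus_INR, plus_INR by lia.
  apply le_INR in HV. rewrite mult_INR in *.
  set (a := INR m * INR (S V)) in *.
  replace (INR m ^ 2 * INR (S V) ^ 2) with (a ^ 2) by (unfold a; ring).
  replace (1 / (a ^ 2 - INR r ^ 2)) with (/ (a - INR r) * / (a + INR r)).
  2:{ field. repeat split; apply Rgt_not_eq; nra. }
  field_simplify_eq; [ring|lra].
Qed.

Lemma ex_series_coef (m r : nat) : (r < m)%nat ->
  ex_series (fun k => 1 / (INR m ^ 2 * INR (S k) ^ 2 - INR r ^ 2)).
Proof.
intros Hm. pose proof (pos_INR r) as Hr.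
assert (H1 : INR r + 1 <= INR m) by (rewrite <- S_INR; apply le_INR; lia).
(* [2 / ((k + 1) (k + 2))], written so that it telescopes, dominates. *)
apply (ex_series_le (K := R_AbsRing) (V := R_CompleteNormedModule) _
  (fun k => 2 * (/ INR (S k) - / INR (S (S k))))).
- intros k. pose proof (pos_INR k) as Hk.
  change norm with Rabs. rewrite !S_INR.
  set (x := INR k) in *.
  assert (Hx : (x + 1) ^ 2 <= INR m ^ 2 * (x + 1) ^ 2 - INR r ^ 2).
  { assert (1 <= (x + 1) ^ 2) by nra.
    assert (INR r ^ 2 + 1 <= INR m ^ 2) by nra.
    assert (INR r ^ 2 * 1 <= INR r ^ 2 * (x + 1) ^ 2)
      by (apply Rmult_le_compat_l; nra).
    nra. }
  assert (Hx0 : 0 < (x + 1) ^ 2) by nra.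
  unfold Rdiv. rewrite Rmult_1_l, Rabs_pos_eq.
  2:{ apply Rlt_le, Rinv_0_lt_compat. lra. }
  replace (2 * (/ (x + 1) - / (x + 1 + 1)))
    with (/ ((x + 1) * (x + 2) / 2)) by (field; lra).
  apply Rinv_le_contravar; nra.
- exists (2 * (1 - 0)).
  change (is_lim_seq (sum_n (fun k => 2 * (/ INR (S k) - / INR (S (S k)))))
            (2 * (1 - 0))).
  apply (is_lim_seq_ext (fun n => 2 * (1 - / INR (S (S n))))).
  + intros n. induction n as [|n IH].
    * rewrite sum_O. simpl. field.
    * rewrite sum_Sn, <- IH. unfold plus; cbn -[INR]. ring_R.
  + apply (is_lim_seq_scal_l _ 2 (Finite (1 - 0))).
    apply is_lim_seq_minus'; [apply is_lim_seq_const|].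
    apply (is_lim_seq_of_rate _ _ 1). intros n.
    rewrite Rminus_0_r, Rmult_1_l.
    pose proof (INR_S_pos n) as Hn. rewrite S_INR.
    rewrite Rabs_pos_eq by (apply Rlt_le, Rinv_0_lt_compat; lra).
    apply Rinv_le_contravar; lra.
Qed.

(** The term of [coef_partial] outside the difference is [O (1 / V)]. *)
Lemma is_lim_seq_coef (m r : nat) : (1 <= r)%nat -> (r < m)%nat ->
  is_lim_seq (fun V => residue_sum m V r - residue_sum m V (m - r)) (coef m r).
Proof.
intros Hr Hm. apply is_lim_seq_incr_1.
pose proof (Series_correct _ (ex_series_coef m r Hm)) as Hs.
set (a := fun k => 1 / (INR m ^ 2 * INR (S k) ^ 2 - INR r ^ 2)) in *.
change (is_lim_seq (sum_n a) (Series a)) in Hs.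
apply (is_lim_seq_ext (fun V => 1 / INR r - 2 * INR r * sum_n a V
                                - / INR (m * S V + r))).
{ intros V. unfold sum_n, a.
  rewrite (sum_n_m_S (fun v => 1 / (INR m ^ 2 * INR v ^ 2 - INR r ^ 2))).
  rewrite coef_partial by easy. ring. }
unfold coef. fold a.
replace (1 / INR r - 2 * INR r * Series a)
  with (1 / INR r - 2 * INR r * Series a - 0) by ring.
apply is_lim_seq_minus'.
- apply is_lim_seq_minus'; [apply is_lim_seq_const|].
  exact (is_lim_seq_scal_l _ (2 * INR r) (Finite _) Hs).
- apply (is_lim_seq_of_rate _ _ 1). intros V.
  rewrite Rminus_0_r, Rmult_1_l.
  assert (H : (S V <= m * S V + r)%nat) by nia.
  apply le_INR in H. pose proof (INR_S_pos V).
  rewrite Rabs_pos_eq by (apply Rlt_le, Rinv_0_lt_compat; lra).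
  apply Rinv_le_contravar; lra.
Qed.

Lemma coef_reflect (m r : nat) : (1 <= r)%nat -> (r < m)%nat ->
  coef m (m - r) = - coef m r.
Proof.
intros Hr Hm.
pose proof (is_lim_seq_coef m (m - r) ltac:(lia) ltac:(lia)) as H1.
pose proof (is_lim_seq_coef m r Hr Hm) as H2.
replace (m - (m - r))%nat with r in H1 by lia.
apply is_lim_seq_opp in H2.
apply is_lim_seq_unique in H1, H2.
rewrite (Lim_seq_ext _ (fun V =>
  residue_sum m V (m - r) - residue_sum m V r)) in H2 by (intros; ring).
rewrite H1 in H2. simpl in H2. congruence.
Qed.

Lemma is_lim_seq_sum (u : nat -> nat -> R) (l : nat -> R) (M : nat) :
  (forall r, (1 <= r <= M)%nat -> is_lim_seq (u r) (l r)) ->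
  is_lim_seq (fun V => sum_n_m (fun r => u r V) 1 M) (sum_n_m l 1 M).
Proof.
induction M as [|M IH]; intros H.
- rewrite sum_R_0. apply (is_lim_seq_ext (fun _ => 0)).
  + intros V. symmetry. apply sum_R_0.
  + apply is_lim_seq_const.
- rewrite sum_R_S.
  apply (is_lim_seq_ext (fun V => sum_n_m (fun r => u r V) 1 M + u (S M) V)).
  + intros V. symmetry. apply (sum_R_S (fun r => u r V)).
  + apply is_lim_seq_plus'; [apply IH; intros r Hr|]; apply H; lia.
Qed.

(** * The finite Fourier expansion of the sawtooth *)

Definition angle (m j : nat) : R := 2 * PI * INR j / INR m.

Lemma angle_shift (m j V r : nat) : (1 <= m)%nat ->
  INR (m * V + r) * angle m j = INR r * angle m j + 2 * INR (V * j) * PI.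
Proof.
intros Hm. pose proof (lt_0_INR m Hm). unfold angle.
rewrite plus_INR, !mult_INR. field. lra.
Qed.

Lemma angle_reflect (m j r : nat) : (1 <= m)%nat -> (r <= m)%nat ->
  INR (m - r) * angle m j = - (INR r * angle m j) + 2 * INR j * PI.
Proof.
intros Hm Hr. pose proof (lt_0_INR m Hm). unfold angle.
rewrite minus_INR by easy. field. lra.
Qed.

(** Reflecting [r] to [m - r] changes the sign of [coef] and not the cosine. *)
Lemma cos_coef_sum (m j : nat) : (1 <= m)%nat ->
  sum_n_m (fun r => cos (INR r * angle m j) * coef m r) 1 (m - 1) = 0.
Proof.
intros Hm. set (f := fun r => cos (INR r * angle m j) * coef m r).
assert (H : sum_n_m f 1 (m - 1) = (-1) * sum_n_m f 1 (m - 1)).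
{ rewrite <- sum_R_reverse at 1. rewrite <- sum_R_scal.
  apply sum_R_ext. intros r Hr. unfold f.
  replace (S (m - 1) - r)%nat with (m - r)%nat by lia.
  rewrite angle_reflect, cos_period, cos_neg, coef_reflect by lia. ring. }
lra.
Qed.

(** Sort [k <= m V] by residue class: the sine depends only on the class and
    vanishes on the multiples of [m]. *)
Lemma sine_sum_by_residue (m j V : nat) : (1 <= m)%nat ->
  sum_n_m (fun k => sin (INR k * angle m j) / INR k) 1 (m * V)
  = sum_n_m (fun r => sin (INR r * angle m j) * residue_sum m V r) 1 (m - 1).
Proof.
intros Hm. assert (Hcat : forall (f : nat -> R) a b, sum_n_m f 1 (a + b)
   = sum_n_m f 1 a + sum_n_m (fun r => f (a + r)%nat) 1 b).
{ intros f a b. induction b as [|b IH].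
  - rewrite Nat.add_0_r, sum_R_0. symmetry. apply Rplus_0_r.
  - rewrite Nat.add_succ_r, !sum_R_S, IH, Nat.add_succ_r. apply Rplus_assoc. }
assert (Hlast : forall f : nat -> R,
   sum_n_m f 1 m = sum_n_m f 1 (m - 1) + f m).
{ intros f. rewrite <- (Nat.sub_add 1 m Hm) at 1 3. rewrite Nat.add_1_r.
  apply sum_R_S. }
induction V as [|V IH].
- rewrite Nat.mul_0_r, sum_R_0. symmetry. apply sum_R_zero. intros r _.
  unfold residue_sum. rewrite sum_R_0. apply Rmult_0_r.
- rewrite Nat.mul_succ_r, Hcat, IH, Hlast.
  replace (sin (INR (m * V + m) * angle m j)) with 0.
  2:{ replace (m * V + m)%nat with (m * S V + 0)%nat by lia.
      rewrite angle_shift, sin_period by easy. simpl.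
      now rewrite Rmult_0_l, sin_0. }
  rewrite (sum_R_ext (fun r => sin (INR r * angle m j) * residue_sum m (S V) r)
    (fun r => sin (INR r * angle m j) * residue_sum m V r
      + sin (INR (m * V + r) * angle m j) / INR (m * V + r))).
  + rewrite sum_R_plus. unfold Rdiv. ring_R.
  + intros r _. rewrite residue_sum_S, angle_shift, sin_period by easy.
    unfold Rdiv. ring.
Qed.

(** By [angle_reflect] the sine is odd under reflection of [r], so both halves of
    [is_lim_seq_coef] contribute the same sum. *)
Lemma sin_coef_sum (m j : nat) : (0 < j < m)%nat ->
  sum_n_m (fun r => sin (INR r * angle m j) * coef m r) 1 (m - 1)
  = PI - angle m j.
Proof.
intros Hj. assert (Hm : (1 <= m)%nat) by lia.
assert (H1 : is_lim_seq (fun V =>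
    sum_n_m (fun k => sin (INR k * angle m j) / INR k) 1 (m * V))
    ((PI - angle m j) / 2)).
{ apply (is_lim_seq_subseq
    (fun K => sum_n_m (fun k => sin (INR k * angle m j) / INR k) 1 K)).
  - apply eventually_subseq. intros V. nia.
  - apply sine_series. pose proof PI_RGT_0.
    assert (0 < INR j < INR m) by (split; [apply lt_0_INR|apply lt_INR]; lia).
    unfold angle. split.
    + apply Rdiv_lt_0_compat; nra.
    + apply Rlt_div_l; nra. }
apply (is_lim_seq_scal_l _ 2 (Finite _)) in H1.
assert (H2 : is_lim_seq (fun V => sum_n_m (fun r => sin (INR r * angle m j)
    * (residue_sum m V r - residue_sum m V (m - r))) 1 (m - 1))
  (sum_n_m (fun r => sin (INR r * angle m j) * coef m r) 1 (m - 1))).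
{ apply (is_lim_seq_sum (fun r V => sin (INR r * angle m j)
    * (residue_sum m V r - residue_sum m V (m - r)))). intros r Hr.
  apply (is_lim_seq_scal_l _ _ (Finite _)). apply is_lim_seq_coef; lia. }
apply (is_lim_seq_ext _ (fun V =>
  2 * sum_n_m (fun k => sin (INR k * angle m j) / INR k) 1 (m * V))) in H2.
- apply is_lim_seq_unique in H1, H2. rewrite H1 in H2. simpl in H2.
  injection H2 as H2. rewrite <- H2. field_R.
- intros V. rewrite sine_sum_by_residue by lia.
  set (f := fun r => sin (INR r * angle m j) * residue_sum m V r).
  rewrite (sum_R_ext _ (fun r => f r + f (S (m - 1) - r)%nat)).
  + rewrite sum_R_plus, sum_R_reverse. ring_R.
  + intros r Hr. unfold f. replace (S (m - 1) - r)%nat with (m - r)%nat by lia.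
    rewrite angle_reflect, sin_period, sin_neg by lia. ring.
Qed.

(** The sawtooth is recovered except at the integers, where its Fourier series
    has the mean value [0] and [- 2 * psi] the value [1]. *)
Lemma sin_coef_sum_psi (m n : nat) : (1 <= m)%nat ->
  sum_n_m (fun r => sin (2 * PI * INR r * INR n / INR m) * coef m r) 1 (m - 1)
  = PI * (- 2 * psi (INR n / INR m) - indicator (divides_b n m)).
Proof.
intros Hm. assert (Hm' : 0 < INR m) by (apply lt_0_INR; lia).
set (j := (n mod m)%nat).
assert (Hj : (j < m)%nat) by (apply Nat.mod_upper_bound; lia).
assert (Hn : INR n = INR m * INR (n / m) + INR j).
{ rewrite <- mult_INR, <- plus_INR. f_equal. apply Nat.div_mod_eq. }
assert (Hpsi : psi (INR n / INR m) = INR j / INR m - 1 / 2).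
{ unfold psi. rewrite (frac_part_nat (n / m)).
  - rewrite Hn. field. lra.
  - apply floor_div; [easy|lra]. }
rewrite Hpsi.
rewrite (sum_R_ext _ (fun r => sin (INR r * angle m j) * coef m r)).
2:{ intros r _. f_equal.
    rewrite <- (sin_period (INR r * angle m j) (r * (n / m))).
    f_equal. unfold angle. rewrite mult_INR, Hn. field. lra. }
unfold divides_b. fold j.
destruct (Nat.eqb_spec j 0) as [E|E]; simpl indicator.
- unfold angle. rewrite E. simpl (INR 0). rewrite sum_R_zero.
  + field_R. lra.
  + intros r _. replace (INR r * (2 * PI * 0 / INR m)) with 0 by (field; lra).
    rewrite sin_0. ring.
- rewrite sin_coef_sum by lia. unfold angle. field_R. lra.
Qed.

(** * The exponential sum *)

Lemma sum_C_components (f g : nat -> R) (N : nat) :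
  sum_n_m (fun k => (f k, g k) : C) 1 N = (sum_n_m f 1 N, sum_n_m g 1 N).
Proof.
induction N as [|N IH].
- rewrite !sum_R_0, sum_n_m_zero by lia. reflexivity.
- rewrite !sum_R_S, sum_n_Sm, IH by lia. reflexivity.
Qed.

Lemma Cexp_rotation (m n r : nat) : (1 <= m)%nat ->
  Cexp (2 * RtoC PI * Ci * RtoC (INR r) * RtoC (INR n) / RtoC (INR m))%C
  = (cos (2 * PI * INR r * INR n / INR m), sin (2 * PI * INR r * INR n / INR m)).
Proof.
intros Hm. assert (Hm' : 0 < INR m) by (apply lt_0_INR; lia).
replace (2 * RtoC PI * Ci * RtoC (INR r) * RtoC (INR n) / RtoC (INR m))%C
  with ((0, 2 * PI * INR r * INR n / INR m) : C).
- unfold Cexp; simpl. rewrite exp_0. f_equal; ring.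
- apply injective_projections; simpl; field; lra.
Qed.

Lemma inner_exp_sum (m n : nat) : (1 <= m)%nat ->
  sum_n_m (fun r =>
    (Cexp (2 * RtoC PI * Ci * RtoC (INR r) * RtoC (INR n) / RtoC (INR m))
     * RtoC (coef m r))%C) 1 (m - 1)
  = (0, PI * (- 2 * psi (INR n / INR m) - indicator (divides_b n m))).
Proof.
intros Hm.
rewrite (sum_n_m_ext _ (fun r =>
  (cos (INR r * angle m n) * coef m r,
   sin (2 * PI * INR r * INR n / INR m) * coef m r) : C)).
- rewrite sum_C_components, cos_coef_sum, sin_coef_sum_psi by easy. reflexivity.
- intros r. rewrite Cexp_rotation by easy.
  replace (INR r * angle m n) with (2 * PI * INR r * INR n / INR m)
    by (unfold angle, Rdiv; ring).
  apply injective_projections; simpl; ring.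
Qed.

(** Each [m] dividing [n] loses [1], the gap between [- 2 * psi] and its Fourier
    series at an integer; every other [m] is exact. *)
Lemma A_term_exp_sum (n : nat) :
  (RtoC (A_term (INR n)) - exp_sum (INR n))%C
  = RtoC (sum_n_m (fun m => indicator (divides_b n m)) 1 (Nat.sqrt n)).
Proof.
assert (HN : INR (Nat.sqrt n) <= sqrt (INR n) < INR (Nat.sqrt n) + 1)
  by (apply floor_sqrt; lra).
unfold A_term, exp_sum. rewrite !(sum_upto_nat (Nat.sqrt n)) by easy.
set (N := Nat.sqrt n).
rewrite (sum_n_m_ext_loc _ (fun m =>
  (0, PI * ((- 2) * psi (INR n / INR m) + (-1) * indicator (divides_b n m))) : C)).
2:{ intros m Hm. rewrite inner_exp_sum by lia. f_equal. ring. }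
rewrite (sum_C_components (fun _ => 0)).
rewrite (sum_R_zero (fun _ => 0)) by easy.
rewrite sum_R_scal, sum_R_plus, !sum_R_scal.
pose proof PI_RGT_0.
apply injective_projections; simpl; field; lra.
Qed.

Lemma exp_sum_error_bound (n : nat) :
  Cmod (RtoC (A_term (INR n)) - exp_sum (INR n)) <= 1 * INR (num_div n).
Proof.
rewrite A_term_exp_sum, Cmod_R, Rabs_pos_eq, Rmult_1_l.
- rewrite INR_num_div.
  rewrite (sum_n_m_Chasles _ 1 (Nat.sqrt n) n) by (try apply Nat.sqrt_le_lin; lia).
  pose proof (sum_R_nonneg (fun m => indicator (divides_b n m)) (S (Nat.sqrt n)) n
    (fun k => ind_nonneg _)).
  unfold plus; simpl. lra.
- apply sum_R_nonneg. intros k. apply ind_nonneg.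
Qed.

Theorem theorem1 :
  (forall x : R, 0 < x -> Delta_d x = A_term x + B_term x) /\
  (exists K : R, forall x : R, 0 < x -> Rabs (B_term x) <= K) /\
  (exists K : R, forall n : nat, (0 < n)%nat ->
     Cmod (RtoC (A_term (INR n)) - exp_sum (INR n)) <= K * INR (num_div n)).
Proof.
split; [exact Delta_decomposition|split].
- exists 1. exact B_term_bounded.
- exists 1. intros n _. apply exp_sum_error_bound.
Qed.
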